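(* Let $G$ be a finite simple graph, $S\subseteq E(G)$, and let $G_t=G_t(S)$, $H_t=H_t(S)$ be as in the context. There exists $t_0\in\mathbb{N}$ such that $m_{G_t}(2,\infty)$, $m_{H_t}(2,\infty)$ and $m_{H_t}(-\infty,-2)$ are constant for all $t\ge t_0$.
   Context: For a graph $F$ with adjacency eigenvalues $\lambda_1(F)\ge\cdots\ge\lambda_m(F)$, $m_F(2,\infty)=\#\{i:\lambda_i(F)>2\}$ and $m_F(-\infty,-2)=\#\{i:\lambda_i(F)<-2\}$ (counted with multiplicity). Given $G$ and $S\subseteq E(G)$, for $t\ge1$ the graph $G_t(S)$ is obtained from $G$ by replacing each edge $uv\in S$ by a path $P_{uv}$ of length $t$ ($t$ edges, $t-1$ new internal vertices) between $u$ and $v$. The graph $H_t(S)$ is obtained from $G_{2t+1}(S)$ by deleting the middle edge of each path $P_{uv}$, $uv\in S$. *)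

(* Defs.v *)
From HB Require Import structures.
From mathcomp Require Import all_boot all_order all_algebra.

Set Implicit Arguments.
Unset Strict Implicit.
Unset Printing Implicit Defensive.

Import Order.TTheory GRing.Theory Num.Theory.

Record sgraph := SGraph {
  vertex :> finType;
  adj : rel vertex;
  adj_sym : symmetric adj;
  adj_irr : irreflexive adj }.

Definition edges (G : sgraph) : {set {set G}} :=
  [set [set p.1; p.2] | p : G * G & adj p.1 p.2].

Section Spectrum.
Local Open Scope ring_scope.

Definition adjmx (C : pzSemiRingType) (F : sgraph) : 'M[C]_#|F| :=
  \matrix_(i, j) (adj (enum_val i) (enum_val j))%:R.

(* The roots of the characteristic polynomial, listed with multiplicity. *)
Definition eigenvalues (C : closedFieldType) (n : nat) (A : 'M[C]_n) : seq C :=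
  sval (closed_field_poly_normal (char_poly A)).

(* In a numClosedFieldType, x < y means that y - x is real and positive; the
   eigenvalues of an adjacency matrix are all real, so on them this is the
   usual order of the reals. *)
Definition m_gt2 (C : numClosedFieldType) (F : sgraph) : nat :=
  count (fun x : C => 2 < x) (eigenvalues (adjmx C F)).

Definition m_ltN2 (C : numClosedFieldType) (F : sgraph) : nat :=
  count (fun x : C => x < - 2) (eigenvalues (adjmx C F)).

End Spectrum.

Section Subdivision.
Variables (G : sgraph) (S : {set {set G}}).

(* Each uv in S is represented by exactly one of the pairs (u, v), (v, u); the
   choice of the pair is irrelevant up to isomorphism. *)
Definition arc : finType :=
  {p : G * G | ([set p.1; p.2] \in S) && (enum_rank p.1 < enum_rank p.2)}.

Section Length.
Variable t : nat.

Definition subdiv_vertex : finType := (G + arc * 'I_t.-1)%type.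

(* The k-th vertex, 0 <= k <= t, of the path P_uv of length t:
   u for k = 0, the internal vertex numbered k - 1 for 0 < k < t, v for k = t. *)
Definition path_vertex (p : arc) (k : nat) : subdiv_vertex :=
  if k is k'.+1 then
    if insub k' is Some i then inr (p, i) else inl (val p).2
  else inl (val p).1.

Definition path_edge (p : arc) (k : nat) : rel subdiv_vertex := fun x y =>
  (x == path_vertex p k) && (y == path_vertex p k.+1) ||
  (y == path_vertex p k) && (x == path_vertex p k.+1).

Definition kept_edge : rel subdiv_vertex := fun x y =>
  match x, y with
  | inl u, inl v => adj u v && ([set u; v] \notin S)
  | _, _ => false
  end.

Definition subdiv_adj : rel subdiv_vertex := fun x y =>
  kept_edge x y || [exists p : arc, exists k : 'I_t, path_edge p k x y].

Lemma path_edge_sym p k : symmetric (path_edge p k).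
Proof. by move=> x y; rewrite /path_edge orbC. Qed.

Lemma subdiv_adj_sym : symmetric subdiv_adj.
Proof.
move=> x y; congr (_ || _).
  by case: x y => [u|a] [v|b] //=; rewrite adj_sym setUC.
by apply: eq_existsb => p; apply: eq_existsb => k; apply: path_edge_sym.
Qed.

Lemma path_vertexS p (k : 'I_t) : path_vertex p k != path_vertex p k.+1.
Proof.
have neq12 : (val p).1 != (val p).2.
  by case: p => -[u v] /= /andP[_]; apply: contraTneq => ->; rewrite ltnn.
case: k => -[|k] /= ltkt; first by case: insubP.
rewrite insubT => [|ltk]; first by rewrite -ltnS (ltn_predK ltkt).
case: insubP => //= j _ Ej; apply/eqP=> -[/(congr1 val)/=].
by rewrite Ej => /eqP; rewrite ltn_eqF.
Qed.

Lemma subdiv_adj_irr : irreflexive subdiv_adj.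
Proof.
move=> x; apply/norP; split; first by case: x => //= u; rewrite adj_irr.
apply/existsP=> -[p /existsP[k]]; rewrite /path_edge orbb => /andP[/eqP-> ].
exact/negP/path_vertexS.
Qed.

Definition subdiv : sgraph := SGraph subdiv_adj_sym subdiv_adj_irr.

End Length.

(* The edges of P_uv in G_(2t+1)(S) are numbered from 0 to 2t, so the middle one
   is the edge number t. *)
Definition subdiv_cut_adj (t : nat) : rel (subdiv t.*2.+1) := fun x y =>
  adj x y && ~~ [exists p : arc, path_edge p t x y].

Lemma subdiv_cut_adj_sym t : symmetric (@subdiv_cut_adj t).
Proof.
move=> x y; congr (_ && ~~ _); first exact: adj_sym.
by apply: eq_existsb => p; apply: path_edge_sym.
Qed.

Lemma subdiv_cut_adj_irr t : irreflexive (@subdiv_cut_adj t).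
Proof. by move=> x; rewrite /subdiv_cut_adj adj_irr. Qed.

Definition subdiv_cut (t : nat) : sgraph :=
  SGraph (@subdiv_cut_adj_sym t) (@subdiv_cut_adj_irr t).

End Subdivision.

(* Main.v *)
Require Import Defs.
From Stdlib Require Import Classical.
From mathcomp Require Import all_boot all_order all_algebra.

(* For c = 1 or c = -1, the number of eigenvalues of c A above 2 is the positive
   index of inertia of the form f |-> c f A f^* - 2 |f|^2.  Repeating the last
   value along each path P_uv embeds the functions on G_t into those on G_(t+1)
   and preserves the form: along a path it is, up to boundary terms, minus the sum
   of the |f_k - f_(k+1)|^2.  Extension by zero does the same for H_t and H_(t+1).
   So the three indices do not decrease with t.  The form is nonpositive on the
   functions that vanish on V(G), by |2 f_k f_(k+1)| <= |f_k|^2 + |f_(k+1)|^2, so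
   the indices are at most |V(G)|; hence they are eventually constant. *)

Set Implicit Arguments.
Unset Strict Implicit.
Unset Printing Implicit Defensive.

Import Order.TTheory GRing.Theory Num.Theory.
Local Open Scope ring_scope.

(** * Hermitian forms and counts of eigenvalues *)

Section HermitianForms.
Local Open Scope sesquilinear_scope.
Variable C : numClosedFieldType.

Definition hform n (A : 'M[C]_n) (x : 'rV_n) : C := (x *m A *m x^t*) 0 0.

Lemma char_poly_conj (R : comUnitRingType) n (A P : 'M[R]_n) :
  P \in unitmx -> char_poly (invmx P *m A *m P) = char_poly A.
Proof.
move=> uP; pose Q := map_mx (@polyC R) P; pose Q' := map_mx (@polyC R) (invmx P).
have QK : Q' *m Q = 1%:M by rewrite -map_mxM mulVmx // map_mx1.
rewrite /char_poly; have -> : char_poly_mx (invmx P *m A *m P) =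
    Q' *m char_poly_mx A *m Q.
  rewrite /char_poly_mx !map_mxM mulmxBr mulmxBl -/Q -/Q'; congr (_ - _).
  by rewrite mul_mx_scalar -scalemxAl QK scalemx1.
by rewrite !det_mulmx mulrAC -det_mulmx QK det1 mul1r.
Qed.

(** The list [eigenvalues] is a chosen factorization of the characteristic polynomial, so it is
    determined only up to order; unique factorization into linear factors gives the permutation. *)
Lemma eigenvalues_diagonalized n (d : 'rV[C]_n) (P : 'M_n) : P \in unitmx ->
  perm_eq (eigenvalues (invmx P *m diag_mx d *m P)) [seq d 0 i | i <- enum 'I_n].
Proof.
move=> uP; apply: prod_XsubC_eq; rewrite big_map big_enum /eigenvalues.
case: closed_field_poly_normal => r /=.
rewrite (monicP (char_poly_monic _)) scale1r => <-.
rewrite char_poly_conj // char_poly_trig ?diag_mx_is_trig //.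
by apply: eq_bigr => i _; rewrite mxE eqxx mulr1n.
Qed.

(** A basis that diagonalizes [A] also diagonalizes [- A]. This turns a count below -2 into a count
    above 2. *)
Lemma eigenvalues_opp n (A : 'M[C]_n) : A \is hermsymmx ->
  perm_eq (eigenvalues (- A)) [seq - x | x <- eigenvalues A].
Proof.
move=> /hermitian_normalmx/orthomx_spectralP.
set P := spectralmx A; set d := spectral_diag A => eA.
have uP : P \in unitmx by exact: spectral_unit.
have -> : - A = invmx P *m diag_mx (- d) *m P.
  by rewrite raddfN /= mulmxN mulNmx -eA.
apply: (perm_trans (eigenvalues_diagonalized _ uP)).
rewrite eA perm_sym; apply: (perm_trans (perm_map _ (eigenvalues_diagonalized _ uP))).
rewrite -map_comp; apply/permP => p; congr count.
by apply: eq_map => i /=; rewrite !mxE.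
Qed.

(** The spectral theorem in the coordinates [x *m P]. One basis serves every shift [a], since
    conjugation fixes scalar matrices; unitarity of the eigenvector matrix makes the form a weighted
    sum of squared moduli. *)
Lemma hermitian_diagonalization n (A : 'M[C]_n) : A \is hermsymmx ->
  exists P : 'M_n, exists d : 'rV[C]_n,
  [/\ P \in unitmx, forall i, d 0 i \is Num.real,
      perm_eq (eigenvalues A) [seq d 0 i | i <- enum 'I_n] &
      forall x (a : C), hform (A - a%:M) x =
                 \sum_i (d 0 i - a) * `|(x *m P) 0 i| ^+ 2].
Proof.
move=> hA; set P := spectralmx A; set d := spectral_diag A.
have uP : P \is unitarymx by exact: spectral_unitarymx.
have uP1 : P \in unitmx by exact: spectral_unit.
have eA : A = invmx P *m diag_mx d *m P.
  exact/orthomx_spectralP/hermitian_normalmx.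
exists (invmx P), d; split.
- by rewrite unitmx_inv.
- by move=> i; have /mxOverP := hermitian_spectral_diag_real hA; apply.
- by rewrite eA; exact: eigenvalues_diagonalized.
move=> x a; have -> : A - a%:M = invmx P *m diag_mx (d - const_mx a) *m P.
  rewrite raddfB /= diag_const_mx mulmxBr mulmxBl -eA; congr (_ - _).
  by rewrite mul_mx_scalar -scalemxAl mulVmx // scalemx1.
rewrite /hform; set D := diag_mx _.
have -> : x *m (invmx P *m D *m P) *m x^t* =
    (x *m invmx P) *m D *m (x *m invmx P)^t*.
  rewrite invmx_unitary // trmx_mul map_mxM /= trmxCK.
  by rewrite !mulmxA.
rewrite mxE; apply: eq_bigr => i _.
by rewrite mul_mx_diag !mxE normCK mulrA [_ * (d 0 i - a)]mulrC.
Qed.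

Definition count_gt (a : C) n (A : 'M[C]_n) : nat :=
  count (fun x => a < x) (eigenvalues A).

(* If A had more eigenvalues above a than B has above b, some x <> 0 would lie in
   the span of the eigenvectors of A above a while x *m T is orthogonal to the
   eigenvectors of B above b. *)
Lemma count_gt_le m n (A : 'M[C]_m) (B : 'M[C]_n) (T : 'M_(m, n)) (a b : C) :
  A \is hermsymmx -> B \is hermsymmx -> a \is Num.real -> b \is Num.real ->
  (forall x, 0 < hform (A - a%:M) x -> 0 < hform (B - b%:M) (x *m T)) ->
  (count_gt a A <= count_gt b B)%N.
Proof.
move=> /hermitian_diagonalization[P [d [uP rd pA fA]]].
move=> /hermitian_diagonalization[Q [e [uQ re pB fB]]] ra rb AB.
set I := [pred i | a < d 0 i]; set J := [pred j | b < e 0 j].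
have -> : count_gt a A = #|I|.
  by rewrite /count_gt (permP pA) count_map -sum1_count -sum1_card big_enum_cond.
have -> : count_gt b B = #|J|.
  by rewrite /count_gt (permP pB) count_map -sum1_count -sum1_card big_enum_cond.
rewrite leqNgt; apply/negP => ltJI.
(* The kernel of [M] consists of the x with no component in the eigenvectors of A outside [I] and
   with [x *m T] having none in those of B in [J]. As #|J| < #|I|, [M] has fewer than m columns, so
   this kernel is nonzero. *)
pose M := row_mx (colsub (fun i : 'I_#|[predC I]| => enum_val i) P)
                 (colsub (fun j : 'I_#|J| => enum_val j) (T *m Q)).
have : kermx M != 0.
  rewrite -mxrank_eq0 mxrank_ker -lt0n subn_gt0.
  apply: leq_ltn_trans (rank_leq_col _) _.
  by rewrite -[ltnRHS](card_ord m) -(cardC I) addnC ltn_add2r.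
move=> /rowV0Pn[x /sub_kermxP xM x0].
have [xP xTQ] : (forall i, ~~ (a < d 0 i) -> (x *m P) 0 i = 0) /\
    (forall j, b < e 0 j -> (x *m T *m Q) 0 j = 0).
  move: xM; rewrite mul_mx_row -[RHS]row_mx0 => /eq_row_mx[xP xTQ].
  split=> i Hi.
    have Hi' : i \in [predC I] by [].
    have /matrixP/(_ 0 (enum_rank_in Hi' i)) := xP.
    rewrite !mxE => xP0; rewrite -[RHS]xP0.
    by apply: eq_bigr => k _; rewrite mxE enum_rankK_in.
  have Hi' : i \in J by [].
  have /matrixP/(_ 0 (enum_rank_in Hi' i)) := xTQ.
  rewrite -mulmxA !mxE => xP0; rewrite -[RHS]xP0.
  by apply: eq_bigr => k _; rewrite !mxE enum_rankK_in.
(* [P] is invertible, so some eigencoordinate of x is nonzero; its index must lie in [I], which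
   makes the form strictly positive. *)
have : 0 < hform (A - a%:M) x.
  have /rV0Pn[i yi] : x *m P != 0 by rewrite -(mul0mx _ P) (can_eq (mulmxK uP)).
  have di : a < d 0 i by apply: contraNT yi => /xP ->.
  rewrite fA (bigD1 i) //= ltr_pwDl //.
    by rewrite mulr_gt0 ?subr_gt0 // exprn_gt0 // normr_gt0.
  apply: sumr_ge0 => j _; have [dj|/xP->] := boolP (a < d 0 j).
    by rewrite mulr_ge0 ?exprn_ge0 // subr_ge0 ltW.
  by rewrite normr0 expr0n mulr0.
move=> /AB; rewrite fB real_ltNge ?realE ?lexx //; last first.
  apply: sum_real => j _; apply: realM; first by rewrite realB.
  by rewrite realX ?normr_real.
case/negP; apply: sumr_le0 => j _.
have [/xTQ->|] := boolP (b < e 0 j); first by rewrite normr0 expr0n mulr0.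
by rewrite -real_leNgt // => ej; rewrite mulr_le0_ge0 ?exprn_ge0 ?subr_le0.
Qed.

End HermitianForms.

(** * The quadratic form of a graph *)

Section GraphForms.
Local Open Scope sesquilinear_scope.
Variable C : numClosedFieldType.

Definition gform (F : sgraph) (c : C) (f : F -> C) : C :=
  c * (\sum_x \sum_(y | adj x y) f x * (f y)^*) - 2 * \sum_x f x * (f x)^*.

(** Passes from row vectors indexed by ranks to functions on vertices, on which maps between graphs
    act. *)
Lemma hform_adjmx (F : sgraph) c (x : 'rV[C]_#|F|) :
  hform (c *: adjmx C F - 2%:M) x = gform c (fun v => x 0 (enum_rank v)).
Proof.
have big_rank (g : F -> C) : \sum_v g v = \sum_(i < #|F|) g (enum_val i).
  by rewrite (reindex _ (onW_bij _ (@enum_val_bij F))).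
rewrite /hform mulmxBr mulmxBl [LHS]mxE [X in _ + X]mxE /gform; congr (_ - _).
  rewrite -scalemxAr -scalemxAl mxE; congr (_ * _).
  rewrite mxE; under eq_bigr => j _ do rewrite mxE big_distrl /=.
  rewrite exchange_big big_rank; apply: eq_bigr => i _.
  rewrite [RHS]big_mkcond big_rank; apply: eq_bigr => j _.
  by rewrite !mxE !enum_valK; case: adj; rewrite ?mulr1 ?mulr0 ?mul0r.
rewrite mul_mx_scalar -scalemxAl mxE; congr (_ * _).
by rewrite mxE big_rank; apply: eq_bigr => i _; rewrite !mxE enum_valK.
Qed.

Lemma scale_adjmx_hermitian (F : sgraph) (c : C) :
  c \is Num.real -> c *: adjmx C F \is hermsymmx.
Proof.
move=> rc; apply: realsym_hermsym.
  apply/is_hermitianmxP; rewrite expr0 scale1r map_mx_id //.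
  by apply/matrixP => i j; rewrite !mxE adj_sym.
by apply/mxOverP => i j; rewrite !mxE realM ?realn.
Qed.

Lemma m_gt2E (F : sgraph) : m_gt2 C F = count_gt 2 (1 *: adjmx C F).
Proof. by rewrite scale1r. Qed.

Lemma m_ltN2E (F : sgraph) : m_ltN2 C F = count_gt 2 (-1 *: adjmx C F).
Proof.
have hA : adjmx C F \is hermsymmx.
  by rewrite -[adjmx C F]scale1r scale_adjmx_hermitian ?real1.
rewrite /count_gt scaleN1r (permP (eigenvalues_opp hA)) count_map.
by apply: eq_count => x /=; rewrite ltrNr.
Qed.

(** A partial map [tau] covers both ways of extending functions: repetition of values, and extension
    by zero where [tau] is [None]. The extension is linear, with matrix [T], so [count_gt_le]
    applies. *)
Lemma count_gt2_pullback (F F' : sgraph) (c : C) (tau : F' -> option F) :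
  c \is Num.real ->
  (forall f : F -> C, 0 < gform c f -> 0 < gform c (fun y => oapp f 0 (tau y))) ->
  (count_gt 2 (c *: adjmx C F) <= count_gt 2 (c *: adjmx C F'))%N.
Proof.
move=> rc FF'.
pose T : 'M[C]_(#|F|, #|F'|) :=
  \matrix_(i, j) (tau (enum_val j) == Some (enum_val i))%:R.
apply: (count_gt_le (T := T)); rewrite ?scale_adjmx_hermitian ?realn // => x.
rewrite !hform_adjmx => /FF'; congr (0 < _).
have eT y : oapp (fun v => x 0 (enum_rank v)) 0 (tau y) = (x *m T) 0 (enum_rank y).
  rewrite mxE; case E: (tau y) => [v|] /=.
    rewrite (bigD1 (enum_rank v)) //= mxE !enum_rankK E eqxx mulr1 big1 ?addr0 //.
    move=> i ni; rewrite mxE enum_rankK E (inj_eq (@Some_inj _)).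
    by rewrite -(can_eq enum_valK) enum_rankK in ni; rewrite eq_sym (negPf ni) mulr0.
  by rewrite big1 // => i _; rewrite mxE enum_rankK E mulr0.
rewrite /gform; congr (_ * _ - _ * _).
  by apply: eq_bigr => u _; apply: eq_bigr => v _; rewrite !eT.
by apply: eq_bigr => u _; rewrite eT.
Qed.

Lemma count_gt_size n (a : C) (A : 'M[C]_n) : (count_gt a A <= n)%N.
Proof.
rewrite (leq_trans (count_size _ _)) // -ltnS /eigenvalues.
case: closed_field_poly_normal => r /=.
move=> /(congr1 (fun p : {poly C} => size p)).
by rewrite size_char_poly (monicP (char_poly_monic A)) scale1r size_prod_XsubC => ->.
Qed.

(** A function on which the form is positive has nonzero restriction along [iota], hence a
    restriction of positive squared norm. So the form is compared with the identity matrix of size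
    #|D| and threshold 0. *)
Lemma count_gt2_bound (F : sgraph) (c : C) (D : finType) (iota : D -> F) :
  c \is Num.real ->
  (forall f : F -> C, (forall u, f (iota u) = 0) -> gform c f <= 0) ->
  (count_gt 2 (c *: adjmx C F) <= #|D|)%N.
Proof.
move=> rc F0.
pose T : 'M[C]_(#|F|, #|D|) := \matrix_(i, j) (i == enum_rank (iota (enum_val j)))%:R.
have hE (x : 'rV[C]_#|D|) : hform (1%:M - 0%:M) x = \sum_i `|x 0 i| ^+ 2.
  rewrite raddf0 subr0 /hform mulmx1 mxE; apply: eq_bigr => i _.
  by rewrite !mxE normCK.
apply: leq_trans (count_gt_size 0 (1%:M : 'M[C]_#|D|)).
apply: (count_gt_le (T := T)); rewrite ?scale_adjmx_hermitian ?realn //.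
  apply: realsym_hermsym; last by apply/mxOverP => i j; rewrite mxE realn.
  by apply/is_hermitianmxP; rewrite expr0 scale1r map_mx_id // trmx1.
move=> x; rewrite hform_adjmx => pos.
have xT i : (x *m T) 0 i = x 0 (enum_rank (iota (enum_val i))).
  rewrite mxE (bigD1 (enum_rank (iota (enum_val i)))) //= mxE eqxx mulr1.
  by rewrite big1 ?addr0 // => j nj; rewrite mxE (negPf nj) mulr0.
rewrite hE lt_neqAle sumr_ge0 => [|i _]; last by rewrite exprn_ge0.
rewrite andbT eq_sym; apply/negP => /eqP xT0.
have x0 u : x 0 (enum_rank (iota u)) = 0.
  have /psumr_eq0P := xT0 => /(_ (fun i _ => exprn_ge0 2 (normr_ge0 _))).
  move=> /(_ (enum_rank u) isT) /eqP; rewrite expf_eq0 /= normr_eq0 xT enum_rankK.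
  by move/eqP.
by have := F0 (fun v => x 0 (enum_rank v)) x0; rewrite lt_geF.
Qed.

End GraphForms.

(** * Vertices and edges of the subdivided paths *)

Section PathEdges.
Variables (G : sgraph) (S : {set {set G}}) (t : nat).
Hypothesis t_gt1 : (1 < t)%N.

(** Inverts [path_vertex t p]; the values off the path of [p] are meaningless. *)
Definition path_pos (p : Defs.arc S) (x : subdiv_vertex S t) : nat :=
  match x with inl u => if u == (val p).1 then 0 else t | inr a => a.2.+1 end.

Lemma arc_neq (p : Defs.arc S) : (val p).1 != (val p).2.
Proof. by case: p => -[u v] /= /andP[_]; apply: contraTneq => ->; rewrite ltnn. Qed.

Lemma path_vertexK (p : Defs.arc S) k : (k <= t)%N -> path_pos p (path_vertex t p k) = k.
Proof.
case: k => [|k] /= kt; first by rewrite eqxx.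
case: insubP => [i _ <- //|]; rewrite /= eq_sym (negPf (arc_neq p)) -leqNgt => tk.
by apply/eqP; rewrite eqn_leq kt andbT -(ltn_predK t_gt1) ltnS.
Qed.

Definition vertex_arc (x : subdiv_vertex S t) : option (Defs.arc S) :=
  match x with inl _ => None | inr a => Some a.1 end.

Lemma vertex_arc_path (p : Defs.arc S) k :
  vertex_arc (path_vertex t p k) = if (0 < k < t)%N then Some p else None.
Proof.
case: k => //= k; case: insubP => /= [i|].
  by rewrite -ltnS (ltn_predK t_gt1) => ->.
by rewrite -ltnS (ltn_predK t_gt1) => /negPf->.
Qed.

Lemma path_vertex_neq (p : Defs.arc S) k :
  (k < t)%N -> path_vertex t p k.+1 != path_vertex t p k.
Proof.
move=> kt; apply/eqP => /(congr1 (path_pos p)).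
by rewrite !path_vertexK ?(ltnW kt) // => /eqP; rewrite eqn_leq ltnn.
Qed.

(** Since t > 1, a path edge has an internal endpoint, which determines the path; the positions of
    its two ends add up to 2k+1, which determines k. *)
Lemma path_edge_uniq (p q : Defs.arc S) (k l : 'I_t) (x y : subdiv_vertex S t) :
  path_edge p k x y -> path_edge q l x y -> (p, k) = (q, l).
Proof.
have arcE (r : Defs.arc S) (m : 'I_t) : path_edge r m x y ->
    (if vertex_arc x is Some s then Some s else vertex_arc y) = Some r.
  have mt := ltn_ord m.
  have [m0|m0] := posnP m.
    by case/orP=> /andP[/eqP-> /eqP->]; rewrite !vertex_arc_path m0 /= t_gt1.
  case/orP=> /andP[/eqP-> /eqP->]; rewrite !vertex_arc_path m0 mt //=.
  by case: ifP.
move=> Ep Eq; have := arcE _ _ Ep; rewrite (arcE _ _ Eq) => -[epq].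
subst q; congr (_, _); apply: val_inj => /=.
have posE (m : 'I_t) : path_edge p m x y ->
    (path_pos p x + path_pos p y = m.*2.+1)%N.
  have mt := ltn_ord m.
  case/orP=> /andP[/eqP-> /eqP->]; rewrite !path_vertexK ?(ltnW mt) //.
    by rewrite addnS addnn.
  by rewrite addSn addnn.
by move: (posE _ Ep); rewrite (posE _ Eq) => -[/double_inj].
Qed.

Lemma path_edge_not_kept (p : Defs.arc S) (k : 'I_t) (x y : subdiv_vertex S t) :
  path_edge p k x y -> kept_edge x y = false.
Proof.
move=> E; case: x y E => [u|a] [v|b] //.
have kt := ltn_ord k.
have : exists2 z, z = path_vertex t p k \/ z = path_vertex t p k.+1 & vertex_arc z = Some p.
  have [k0|k0] := posnP k.
    by exists (path_vertex t p k.+1); [right|rewrite vertex_arc_path k0 /= t_gt1].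
  by exists (path_vertex t p k); [left|rewrite vertex_arc_path k0 kt].
by case=> z Hz zp /orP[]/andP[/eqP eu /eqP ev]; move: zp; case: Hz => ->; rewrite -?eu -?ev.
Qed.

(** [K] selects the path edges that are present: all of them in $G_t$, all but the middle one in
    $H_t$. An adjacent pair arises in only one way, so no term is counted twice. *)
Lemma sum_path_edges (V : nmodType) (K : pred nat) (e : rel (subdiv_vertex S t))
    (g : subdiv_vertex S t -> subdiv_vertex S t -> V) :
  (forall x y, e x y = kept_edge x y ||
     [exists p : Defs.arc S, exists k : 'I_t, K k && path_edge p k x y]) ->
  \sum_x \sum_(y | e x y) g x y =
    \sum_u \sum_(v | adj u v && ([set u; v] \notin S)) g (inl u) (inl v) +
    \sum_p \sum_(k < t | K k) (g (path_vertex t p k) (path_vertex t p k.+1) +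
                               g (path_vertex t p k.+1) (path_vertex t p k)).
Proof.
move=> eE.
pose h (pk : Defs.arc S * 'I_t) x y := if K pk.2 && path_edge pk.1 pk.2 x y then g x y else 0.
have split_e x y : (if e x y then g x y else 0) =
    (if kept_edge x y then g x y else 0) + \sum_pk h pk x y.
  rewrite eE; case: existsP => [[p /existsP[k /andP[Kk E]]]|nE].
    rewrite orbT (path_edge_not_kept E) add0r (bigD1 (p, k)) //= {1}/h /= Kk E.
    rewrite big1 ?addr0 // => -[q l] nql; rewrite /h /=; case: ifP => // /andP[_ E'].
    by rewrite (path_edge_uniq E' E) eqxx in nql.
  rewrite orbF big1 ?addr0 // => -[q l] _; rewrite /h /=; case: ifP => // E'.
  by case: nE; exists q; apply/existsP; exists l.
have -> : \sum_x \sum_(y | e x y) g x y =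
    \sum_x \sum_y (if kept_edge x y then g x y else 0) +
    \sum_pk \sum_x \sum_y h pk x y.
  rewrite [X in _ = _ + X]exchange_big -big_split; apply: eq_bigr => x _.
  rewrite [X in _ = _ + X]exchange_big -big_split big_mkcond; apply: eq_bigr => y _.
  exact: split_e.
congr (_ + _).
  rewrite big_sumType /= [X in _ + X]big1 ?addr0 => [|a _]; last by rewrite big1.
  apply: eq_bigr => u _; rewrite big_sumType /= [X in _ + X]big1 ?addr0 //.
  by rewrite -big_mkcond.
rewrite [RHS]pair_big_dep /= [RHS]big_mkcond /=; apply: eq_bigr => -[p k] _ /=.
rewrite /h /=; case: (K k) => /=; last by rewrite big1 // => x _; rewrite big1.
set a := path_vertex t p k; set b := path_vertex t p k.+1.
(* The two orientations of an edge are distinct ordered pairs, so the disjunction in [path_edge]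
   becomes a sum. *)
have ab : b != a by exact: path_vertex_neq.
have delta2 (c d : subdiv_vertex S t) :
    \sum_x \sum_y (if (x == c) && (y == d) then g x y else 0) = g c d.
  by rewrite pair_bigA -big_mkcond (big_pred1 (c, d)).
rewrite -(delta2 a b) -(delta2 b a) -big_split; apply: eq_bigr => x _ /=.
rewrite -big_split; apply: eq_bigr => y _ /=; rewrite /path_edge -/a -/b.
have [->|xa] := eqVneq x a; last by rewrite /= add0r andbC.
by rewrite [a == b]eq_sym (negPf ab) andbF orbF addr0.
Qed.

Lemma sum_subdiv_vertex (V : nmodType) (g : subdiv_vertex S t -> V) :
  \sum_x g x = \sum_u g (inl u) + \sum_p \sum_(i < t.-1) g (path_vertex t p i.+1).
Proof.
rewrite big_sumType /= pair_bigA; congr (_ + _); apply: eq_bigr => -[p i] _ /=.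
by rewrite valK.
Qed.

End PathEdges.

(** * The forms of $G_t$ and $H_t$: monotonicity in t and upper bound *)

Lemma sum_skip_middle (V : nmodType) t (g : nat -> V) :
  \sum_(k < t.*2.+1 | k != t :> nat) g k =
    \sum_(k < t) g k + \sum_(k < t) g (t.+1 + k)%N.
Proof.
rewrite -addnn -addnS big_mkcond big_split_ord big_ord_recl /= addn0 eqxx add0r.
congr (_ + _); apply: eq_bigr => k _; first by rewrite ltn_eqF.
by rewrite /bump add1n addnS addSn gtn_eqF // ltnS leq_addr.
Qed.

Local Arguments path_vertex : simpl never.

Section PathForms.
Variables (C : numClosedFieldType) (G : sgraph) (S : {set {set G}}).
Implicit Type p : Defs.arc S.

Definition sqnorm (z : C) : C := z * z^*.
Definition cross (a : nat -> C) k : C := a k * (a k.+1)^* + a k.+1 * (a k)^*.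
Definition along t (f : subdiv_vertex S t -> C) p k : C := f (path_vertex t p k).

Definition path_form t (K : pred nat) (c : C) (f : subdiv_vertex S t -> C) : C :=
  c * (\sum_u \sum_(v | adj u v && ([set u; v] \notin S)) f (inl u) * (f (inl v))^* +
       \sum_p \sum_(k < t | K k) cross (along f p) k) -
  2 * (\sum_u sqnorm (f (inl u)) + \sum_p \sum_(i < t.-1) sqnorm (along f p i.+1)).

Lemma gform_subdiv t (c : C) (f : subdiv S t -> C) : (1 < t)%N ->
  gform c f = path_form predT c f.
Proof.
move=> t_gt1; rewrite /gform /path_form; congr (_ * _ - _ * _).
  by rewrite (sum_path_edges t_gt1 (K := predT)).
exact: sum_subdiv_vertex.
Qed.

Lemma gform_subdiv_cut t (c : C) (f : subdiv_cut S t -> C) : (0 < t)%N ->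
  gform c f = path_form (fun k => k != t) c f.
Proof.
move=> t_gt0; have t_gt1 : (1 < t.*2.+1)%N by rewrite ltnS double_gt0.
have tt : (t < t.*2.+1)%N by rewrite ltnS -addnn leq_addr.
rewrite /gform /path_form; congr (_ * _ - _ * _); last exact: sum_subdiv_vertex.
rewrite (sum_path_edges t_gt1 (K := fun k => k != t)) // => x y.
rewrite /= /subdiv_cut_adj /= /subdiv_adj.
apply/idP/idP.
  case/andP=> /orP[->//|/existsP[p /existsP[k E]]] /existsP nE.
  apply/orP; right; apply/existsP; exists p; apply/existsP; exists k.
  by rewrite E andbT; apply/negP => /eqP kt; apply: nE; exists p; rewrite kt in E.
case/orP=> [kxy|/existsP[p /existsP[k /andP[kt E]]]].
  rewrite kxy /=; apply/existsP => -[p E].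
  by have := path_edge_not_kept t_gt1 (k := Ordinal tt) E; rewrite kxy.
apply/andP; split.
  by apply/orP; right; apply/existsP; exists p; apply/existsP; exists k.
apply/existsP=> -[q E']; have := path_edge_uniq t_gt1 (l := Ordinal tt) E E'.
by case=> _ ek; rewrite ek eqxx in kt.
Qed.

(** Past position t, [insub] fails and [path_vertex] stays at the end v; this default is what
    repeats the last value on a longer path. *)
Lemma path_vertex_end t p k :
  (0 < t)%N -> (t <= k)%N -> path_vertex t p k = inl (val p).2.
Proof.
rewrite /path_vertex; case: k => [|k] t_gt0 tk; first by rewrite leqNgt t_gt0 in tk.
by case: insubP => // i; rewrite ltn_predRL ltnNge tk.
Qed.

Lemma path_form_le0 t (K : pred nat) (c : C) (f : subdiv_vertex S t -> C) :
  (0 < t)%N -> c \is Num.real -> c ^+ 2 = 1 -> (forall u, f (inl u) = 0) ->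
  path_form K c f <= 0.
Proof.
move=> t_gt0 rc c2 f0; rewrite /path_form.
rewrite [X in c * (X + _)]big1 => [|u _]; last by rewrite big1 // => v _; rewrite f0 mul0r.
rewrite [X in 2 * (X + _)]big1 => [|u _]; last by rewrite f0 /sqnorm mul0r.
rewrite !add0r !mulr_sumr -sumrB; apply: sumr_le0 => p _.
set a := along f p.
(* The end values vanish, so each internal squared norm, taken twice, is shared between the two path
   edges at its vertex. *)
have -> : 2 * \sum_(i < t.-1) sqnorm (a i.+1) =
    \sum_(k < t) (sqnorm (a k) + sqnorm (a k.+1)).
  have a0 : a 0%N = 0 by exact: f0.
  have at0 : a t = 0 by rewrite /a /along path_vertex_end // f0.
  rewrite big_split /= mulr_natl mulr2n; congr (_ + _); case: (t) t_gt0 at0 => // s _ as0.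
    by rewrite big_ord_recl a0 /sqnorm mul0r add0r.
  by rewrite big_ord_recr /= as0 /sqnorm mul0r addr0.
rewrite mulr_sumr subr_le0 big_mkcond; apply: ler_sum => k _.
rewrite /cross /sqnorm; have cc : c^* = c by exact/CrealP.
have pos (z : C) : 0 <= z * z^* by rewrite mul_conjC_ge0.
case: (K k); last by rewrite addr_ge0.
(* As c is real with c^2 = 1, |a_k|^2 + |a_(k+1)|^2 minus c times the cross term is |a_k - c
   a_(k+1)|^2. *)
rewrite -subr_ge0; have := pos (a k - c * a k.+1); congr (_ <= _).
rewrite rmorphB rmorphM /= cc mulrBl !mulrBr [_ * _ * (c * _)]mulrACA -expr2 c2.
by rewrite mul1r [a k * (c * _)]mulrCA -mulrA opprB addrACA mulrDr opprD.
Qed.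

(** Contracts the last edge of each path: the internal vertex at position t goes to
    [path_vertex t p t], which is v. *)
Definition merge_last t (x : subdiv S t.+1) : option (subdiv S t) :=
  match x with
  | inl u => Some (inl u)
  | inr (p, i) => Some (path_vertex t p i.+1)
  end.

Lemma merge_last_path t p k : (1 < t)%N -> (k <= t.+1)%N ->
  merge_last (path_vertex t.+1 p k) = Some (path_vertex t p k).
Proof.
move=> t1 kt; rewrite {1}/path_vertex; case: k kt => //= k kt; case: insubP => [i _ /= ->//|/=].
rewrite -leqNgt => tk.
by rewrite path_vertex_end ?(ltnW t1) // ltnW.
Qed.

(** On each path the additional edge joins two copies of the value f(v) and adds 2|f(v)|^2, while
    the additional vertex subtracts 2|f(v)|^2. This cancellation relies on c = 1. *)
Lemma m_gt2_subdivS t : (1 < t)%N ->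
  (m_gt2 C (subdiv S t) <= m_gt2 C (subdiv S t.+1))%N.
Proof.
move=> t_gt1; rewrite !m_gt2E; apply: (count_gt2_pullback (tau := @merge_last t)).
  exact: real1.
have tS_gt1 : (1 < t.+1)%N by rewrite ltnS ltnW.
move=> f; rewrite !gform_subdiv //; congr (0 < _).
rewrite /path_form; set f' := fun y => oapp f 0 (merge_last y).
have f'E p k : (k <= t.+1)%N -> along f' p k = along f p k.
  by move=> kt; rewrite /along /f' merge_last_path.
have ft p : along f p t.+1 = along f p t.
  by rewrite /along !path_vertex_end ?(ltnW t_gt1).
have -> : \sum_p \sum_(k < t.+1 | predT k) cross (along f' p) k =
    \sum_p \sum_(k < t | predT k) cross (along f p) k + 2 * \sum_p sqnorm (along f p t).
  rewrite mulr_sumr -big_split /=; apply: eq_bigr => p _.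
  rewrite big_ord_recr /= {2}/cross !f'E // ft mulr_natl mulr2n; congr (_ + _).
  by apply: eq_bigr => k _; rewrite /cross !f'E // ltnW // ltnS // ltnW.
have -> : \sum_p \sum_(i < t.+1.-1) sqnorm (along f' p i.+1) =
    \sum_p \sum_(i < t.-1) sqnorm (along f p i.+1) + \sum_p sqnorm (along f p t).
  rewrite -big_split /=; apply: eq_bigr => p _.
  under eq_bigr => i _ do rewrite f'E ?ltnS ?(ltnW (ltn_ord _)) //.
  by move: (along f p) => a; case: (t) t_gt1 => // s _; rewrite big_ord_recr.
by rewrite !mul1r !addrA [2 * (_ + \sum_p sqnorm _)]mulrDr opprD [RHS]addrACA subrr addr0.
Qed.

(** The internal vertex numbered i has position i+1. Positions t+1 and t+2, the ends of the deleted
    middle edge, are the new vertices and go to [None]; later positions move back by 2. *)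
Definition drop_middle t (x : subdiv_cut S t.+1) : option (subdiv_cut S t) :=
  match x with
  | inl u => Some (inl u)
  | inr (p, i) =>
      if (i < t)%N then Some (path_vertex t.*2.+1 p i.+1)
      else if (i < t.+2)%N then None
      else Some (path_vertex t.*2.+1 p i.-1)
  end.

Lemma drop_middle_path t p k :
  drop_middle (path_vertex t.+1.*2.+1 p k) =
    if (k <= t)%N then Some (path_vertex t.*2.+1 p k)
    else if (k <= t.+2)%N then None else Some (path_vertex t.*2.+1 p k.-2).
Proof.
case: k => [|k]; first by [].
rewrite {1}/path_vertex; case: insubP => [i _ /= ->//|/=].
rewrite -leqNgt doubleS => tk; have t2k : (t.+2 <= k)%N.
  by apply: leq_trans tk; rewrite !ltnS -addnn leq_addr.
rewrite (ltnNge k t) (ltnNge k t.+2) t2k (leq_trans _ t2k) ?leqW //=.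
by rewrite path_vertex_end //; case: k tk t2k => [|k].
Qed.

Lemma count_gt2_subdiv_cutS t (c : C) : (0 < t)%N -> c \is Num.real ->
  (count_gt 2 (c *: adjmx C (subdiv_cut S t)) <=
   count_gt 2 (c *: adjmx C (subdiv_cut S t.+1)))%N.
Proof.
move=> t_gt0 rc; apply: (count_gt2_pullback (tau := @drop_middle t)) => // f.
rewrite !gform_subdiv_cut //; congr (0 < _).
rewrite /path_form; set f' := fun y => oapp f 0 (drop_middle y).
have f'lo p k : (k <= t)%N -> along f' p k = along f p k.
  by move=> kt; rewrite /along /f' drop_middle_path kt.
have f'hi p k : along f' p (t.+3 + k)%N = along f p (t.+1 + k)%N.
  have lt3 : (t.+2 < t.+3 + k)%N by exact: leq_addr.
  rewrite /along /f' drop_middle_path (leqNgt _ t) (leqNgt _ t.+2) lt3.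
  by rewrite (leq_trans _ lt3) // leqW.
have f'1 p : along f' p t.+1 = 0.
  by rewrite /along /f' drop_middle_path ltnn leqnSn.
have f'2 p : along f' p t.+2 = 0.
  by rewrite /along /f' drop_middle_path leqnn ltnNge leqnSn.
congr (c * (_ + _) - 2 * (_ + _)); apply: eq_bigr => p _.
  (* The only additional edges are numbers t and t+2; each has an end where the extended function is
     0, so it contributes nothing. *)
  rewrite !sum_skip_middle big_ord_recr big_ord_recl /=; congr (_ + _).
    rewrite [cross _ t]/cross f'1 rmorph0 mulr0 mul0r !addr0.
    by apply: eq_bigr => k _; rewrite /cross !f'lo // ltnW.
  rewrite addn0 [cross _ t.+2]/cross f'2 rmorph0 mulr0 mul0r !add0r.
  apply: eq_bigr => k _; rewrite /bump /= add1n addnS -addSn /cross -!addnS.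
  by rewrite !f'hi.
have sum_double (g : nat -> C) s :
    \sum_(i < s.*2) g i = \sum_(i < s) g i + \sum_(i < s) g (s + i)%N.
  by rewrite -addnn big_split_ord.
rewrite !(sum_double (fun i => sqnorm (along _ p i.+1))) big_ord_recr big_ord_recl /=.
rewrite addn0 f'1 f'2 /sqnorm !mul0r addr0 add0r; congr (_ + _); apply: eq_bigr => k _.
  by rewrite f'lo.
by rewrite /bump /= add1n addnS -!addSn f'hi.
Qed.

Lemma count_gt2_subdiv_cut_bound t (c : C) : (0 < t)%N -> c \is Num.real ->
  c ^+ 2 = 1 -> (count_gt 2 (c *: adjmx C (subdiv_cut S t)) <= #|G|)%N.
Proof.
move=> t_gt0 rc c2.
apply: (count_gt2_bound (iota := inl : G -> subdiv_cut S t)) => // f f0.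
by rewrite gform_subdiv_cut // path_form_le0.
Qed.

Lemma m_gt2_subdiv_bound t : (1 < t)%N -> (m_gt2 C (subdiv S t) <= #|G|)%N.
Proof.
move=> t_gt1; rewrite m_gt2E.
apply: (count_gt2_bound (iota := inl : G -> subdiv S t)) => [|f f0]; first exact: real1.
by rewrite gform_subdiv // path_form_le0 ?real1 ?expr1n // ltnW.
Qed.

End PathForms.

(** * Stationarity and conclusion *)

Lemma bounded_nondecreasing_stationary (f : nat -> nat) a M :
  (forall t, a <= t -> f t <= f t.+1)%N -> (forall t, a <= t -> f t <= M)%N ->
  exists2 t0, (a <= t0)%N & forall t, (t0 <= t)%N -> f t = f t0.
Proof.
(* Induction on the gap M - f(a): either f is constant from a on, or it is larger at some later t,
   and restarting from t shrinks the gap. *)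
have [k] := ubnP (M - f a); elim: k a => // k IH a ltk mono bnd.
have [fa|nfa] := classic (forall t, (a <= t)%N -> f t = f a); first by exists a.
have [t nt] := not_all_ex_not _ _ nfa; have [a_t ft] := imply_to_and _ _ nt.
have fat : (f a <= f t)%N.
  rewrite -(subnKC a_t); elim: (t - a)%N => [|d IHd]; first by rewrite addn0.
  by rewrite addnS (leq_trans IHd) // mono ?leq_addr.
have lt_ft : (f a < f t)%N by rewrite ltn_neqAle fat andbT eq_sym; apply/eqP.
have [||s ts|t0 t_t0] := IH t.
- by apply: leq_trans (ltn_sub2l (leq_trans lt_ft (bnd _ a_t)) lt_ft) _.
- by move=> s ts; apply: mono; apply: leq_trans ts.
- by apply: bnd; apply: leq_trans ts.
by exists t0 => //; apply: leq_trans t_t0.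
Qed.

Local Close Scope ring_scope.

Theorem theorem6p3 (C : numClosedFieldType) (G : sgraph) (S : {set {set G}})
    (sSE : S \subset edges G) :
  exists t0 : nat, 0 < t0 /\ forall t : nat, t0 <= t ->
    [/\ m_gt2 C (subdiv S t) = m_gt2 C (subdiv S t0),
        m_gt2 C (subdiv_cut S t) = m_gt2 C (subdiv_cut S t0) &
        m_ltN2 C (subdiv_cut S t) = m_ltN2 C (subdiv_cut S t0)].
Proof.
(* Used with c = 1 for the eigenvalues of $H_t$ above 2 and with c = -1 for those below -2. *)
have cutP (c : C) : c \is Num.real -> (c ^+ 2 = 1)%R ->
    exists2 t0, 0 < t0 & forall t, t0 <= t ->
      count_gt 2 (c *: adjmx C (subdiv_cut S t))%R =
      count_gt 2 (c *: adjmx C (subdiv_cut S t0))%R.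
  move=> rc c2; apply: (bounded_nondecreasing_stationary (M := #|G|)) => t t_gt0.
    exact: count_gt2_subdiv_cutS.
  exact: count_gt2_subdiv_cut_bound.
have [t1 t1_gt1 eq1] : exists2 t0, 1 < t0 & forall t, t0 <= t ->
    m_gt2 C (subdiv S t) = m_gt2 C (subdiv S t0).
  apply: (bounded_nondecreasing_stationary (M := #|G|)) => t t_gt1.
    exact: m_gt2_subdivS.
  exact: m_gt2_subdiv_bound.
have [t2 t2_gt0 eq2] := cutP 1%R (real1 _) (expr1n _ 2).
have rN1 : (-1)%R \is @Num.real C by rewrite realN real1.
have N1sq : ((-1) ^+ 2 = 1 :> C)%R by rewrite sqrrN expr1n.
have [t3 t3_gt0 eq3] := cutP (-1)%R rN1 N1sq.
exists (maxn t1 (maxn t2 t3)); split; first by rewrite leq_max (ltnW t1_gt1).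
move=> t; rewrite !geq_max => /and3P[le1 le2 le3].
split.
(* Both [t] and the maximum lie past each threshold, so both sides equal the value at that
   threshold. *)
- by rewrite eq1 // [RHS]eq1 // leq_maxl.
- by rewrite !m_gt2E eq2 // [RHS]eq2 // leq_max leq_maxl orbT.
by rewrite !m_ltN2E eq3 // [RHS]eq3 // leq_max leq_maxr orbT.
Qed.
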